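(* Let $C$ be a nonempty bounded closed and convex subset of a uniformly noncreasy Banach space. Then every asymptotically nonexpansive in the intermediate sense mapping $T:C\to C$ has a fixed point.
   Context: A real Banach space $X$ (with closed unit ball $B_X$ and with $S_{X^*}$ the unit sphere of its dual) is uniformly noncreasy if for every $\varepsilon>0$ there is $\delta>0$ such that if $f,g\in S_{X^*}$ and $\|f-g\|\ge\varepsilon$, then $\operatorname{diam}S(f,g,\delta)\le\varepsilon$, where $S(f,g,\delta)=\{x\in B_X: f(x)\ge 1-\delta \text{ and } g(x)\ge 1-\delta\}$ and $\operatorname{diam}\emptyset=0$. A mapping $T:C\to C$ is asymptotically nonexpansive in the intermediate sense if $T$ is continuous and $\limsup_{n\to\infty}\sup_{x,y\in C}(\|T^nx-T^ny\|-\|x-y\|)\le 0$. *)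

(* Defs.v *)
From HB Require Import structures.
From mathcomp Require Import all_boot all_order all_algebra.
From mathcomp Require Import all_classical all_reals all_analysis.

Set Implicit Arguments.
Unset Strict Implicit.
Unset Printing Implicit Defensive.

Import Order.TTheory GRing.Theory Num.Theory.
Import numFieldNormedType.Exports.

Local Open Scope classical_set_scope.
Local Open Scope ring_scope.

Definition unit_ball (R : realType) (X : normedModType R) : set X :=
  [set x | `|x| <= 1].

(* Extended-real valued, so that it makes sense for an arbitrary function; it is
   finite on the differences of continuous linear functionals, for which it is
   the usual operator norm. *)
Definition dual_norm (R : realType) (X : normedModType R) (f : X -> R) : \bar R :=
  ereal_sup [set `|f x|%:E | x in @unit_ball R X].

Definition dual_sphere (R : realType) (X : normedModType R) :
    set {linear X -> R^o} :=
  [set f : {linear X -> R^o} | continuous f /\ dual_norm f = 1%E].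

(* [ereal_sup set0] is [-oo]; taking the maximum with [0], which changes nothing
   for nonempty sets, gives the convention that the diameter of [set0] is [0]. *)
Definition diam (R : realType) (X : normedModType R) (A : set X) : \bar R :=
  Order.max 0%E (ereal_sup [set `|x - y|%:E | x in A & y in A]).

Definition slice2 (R : realType) (X : normedModType R) (f g : X -> R)
    (delta : R) : set X :=
  [set x | [/\ unit_ball x, f x >= 1 - delta & g x >= 1 - delta]].

Definition uniformly_noncreasy (R : realType) (X : normedModType R) : Prop :=
  forall eps : R, 0 < eps -> exists2 delta : R, 0 < delta &
    forall f g : {linear X -> R^o}, dual_sphere f -> dual_sphere g ->
      (eps%:E <= dual_norm (f \- g)%R)%E ->
      (diam (slice2 f g delta) <= eps%:E)%E.

Definition asymptotically_nonexpansive_intermediate (R : realType)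
    (X : normedModType R) (C : set X) (T : X -> X) : Prop :=
  {within C, continuous T} /\
  (limn_esup (fun n => ereal_sup
     [set (`|iter n T x - iter n T y| - `|x - y|)%:E | x in C & y in C]) <= 0)%E.

(* Main.v *)
Require Import Defs.
From HB Require Import structures.
From mathcomp Require Import all_boot all_order all_algebra.
From mathcomp Require Import all_classical all_reals all_analysis.
From mathcomp Require Import ring lra zify.

Import Order.TTheory GRing.Theory Num.Theory.
Import numFieldNormedType.Exports.

Local Open Scope classical_set_scope.
Local Open Scope ring_scope.

Set Implicit Arguments.
Unset Strict Implicit.

(* Weak compactness comes directly from the definition: if the members of a
   filter are at asymptotic distance [t] from a point, then some nearby point is
   at asymptotic distance at most [al * t] with [al < 1], and completeness
   applies.

   Let [K] be a minimal nonempty closed convex set containing the weak limit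
   points of the orbits of its points. For [a] in [K], the asymptotic distance
   [r] from [T^n a] to [p] does not depend on [p] in [K]; if [r = 0], then
   [T^n a --> a] and [T a = a]. Suppose [r > 0], and choose along an ultrafilter
   [k < l] such that [x = T^k a] and [y = T^l a], as well as all their images by
   the iterates of [T], are at distance about [r] from given points of [K] and,
   weak limits being in [K], from each other. Uniform noncreasiness forces the
   metric midpoints of [T^i x] and [T^i y] to be unique, hence
   [T^i ((x + y) / 2)] to be close to [(T^i x + T^i y) / 2]. By minimality of
   [K] again, the latter remains, for suitable [i], at distance about [r] from
   points of [K]. One functional then separates [T^i x] and [T^i y] from two
   points [p] and [q], and another one separates [p] from [T^i x], [T^i y] and
   [q]; since [|T^i x - T^i y|] is about [r], this contradicts uniform
   noncreasiness. *)

(** * The Hahn-Banach theorem *)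

Definition segment_closed (R : realType) (V : lmodType R) (A : set V) :=
  forall x y (t : R), 0 <= t -> t <= 1 -> A x -> A y ->
    A (t *: x + (1 - t) *: y).

Definition sublinear (R : realType) (V : lmodType R) (p : V -> R) :=
  (forall x y, p (x + y) <= p x + p y) /\
  (forall t x, 0 < t -> p (t *: x) <= t * p x).

Section sublinear_theory.
Context (R : realType) (V : lmodType R).
Implicit Types (p q : V -> R) (A : set V).

Lemma sublinear0 p : sublinear p -> p 0 = 0.
Proof.
move=> [pD pZ]; apply/eqP; rewrite eq_le; apply/andP; split.
  by have := pZ 2^-1 0; rewrite scaler0 invr_gt0 ltr0n => /(_ isT); lra.
by have := pD 0 0; rewrite addr0; lra.
Qed.

Lemma sublinearZ p t x : sublinear p -> 0 <= t -> p (t *: x) = t * p x.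
Proof.
move=> sp; rewrite le_eqVlt => /predU1P[<-|t0].
  by rewrite scale0r mul0r sublinear0.
have [pD pZ] := sp.
apply/eqP; rewrite eq_le pZ//= -ler_pdivlMl//.
have ti : 0 < t^-1 by rewrite invr_gt0.
by have := pZ _ (t *: x) ti; rewrite scalerA mulVf ?gt_eqF// scale1r.
Qed.

Lemma sublinear_geN p x : sublinear p -> - p (- x) <= p x.
Proof.
move=> sp; have [pD _] := sp; have := pD x (- x).
by rewrite subrr sublinear0//; lra.
Qed.

(** The witness, the infimum of [q (x + t *: y) - t * d] over [t >= 0] and [y] in [A], is the
    largest sublinear functional below [q] with the required bound. The infimum is finite because
    [d <= q y] on [A]. A singleton [A] serves for Hahn-Banach, the norm as [q] for separation. *)
Lemma sublinear_inf q A (d : R) : sublinear q -> A !=set0 ->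
    segment_closed A -> (forall y, A y -> d <= q y) ->
  exists q', [/\ sublinear q', forall x, q' x <= q x &
    forall y, A y -> q' (- y) <= - d].
Proof.
move=> sq [y0 Ay0] cA dA; have [qD qZ] := sq.
pose E x := [set r | exists t y, [/\ 0 <= t, A y & r = q (x + t *: y) - t * d]].
have E0 x : E x !=set0 by exists (q (x + 0 *: y0) - 0 * d), 0, y0; split.
have Elb x : lbound (E x) (- q (- x)).
  move=> _ [t [y [t0 Ay ->]]].
  have := qD (- x) (x + t *: y); rewrite addKr sublinearZ//.
  by have := ler_wpM2l t0 (dA _ Ay); lra.
have Ehlb x : has_lbound (E x) by exists (- q (- x)).
have infle x r : E x r -> inf (E x) <= r by apply: ge_inf.
exists (fun x => inf (E x)); split.
- split=> [x x'|t x t0].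
    rewrite -lerBlDr; apply: lb_le_inf => // r Er.
    rewrite lerBlDr -lerBlDl; apply: lb_le_inf => // r' Er'.
    rewrite lerBlDl; have [t [y [t0 Ay ->]]] := Er.
    have [s [z [s0 Az ->]]] := Er'.
    have ts0 : 0 <= t + s by rewrite addr_ge0.
    (* Convexity makes the cone over [A] stable under addition; a zero total weight has to be
       treated apart. *)
    have [w Aw wE] : exists2 w, A w & t *: y + s *: z = (t + s) *: w.
      have [ts|ts] := eqVneq (t + s) 0.
        exists y => //.
        have -> : t = 0 by lra.
        have -> : s = 0 by lra.
        by rewrite addr0 !scale0r addr0.
      have tsgt0 : 0 < t + s by rewrite lt_neqAle eq_sym ts.
      exists ((t / (t + s)) *: y + (1 - t / (t + s)) *: z).
        apply: cA => //; first by rewrite divr_ge0.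
        by rewrite ler_pdivrMr// mul1r lerDl.
      rewrite scalerDr !scalerA; congr (_ *: _ + _ *: _); first by field.
      by field.
    apply: (@le_trans _ _ (q (x + x' + (t + s) *: w) - (t + s) * d)).
      by apply: infle; exists (t + s), w.
    have := qD (x + t *: y) (x' + s *: z).
    by rewrite addrACA wE; lra.
  rewrite -ler_pdivrMl//; apply: lb_le_inf => // _ [s [y [s0 Ay ->]]].
  rewrite ler_pdivrMl//; apply: infle.
  exists (t * s), y; split => //; first by rewrite mulr_ge0// ltW.
  rewrite -scalerA -scalerDr sublinearZ//; last exact: ltW.
  by rewrite mulrBr mulrA.
- move=> x; apply: infle; exists 0, y0; split=> //.
  by rewrite scale0r addr0 mul0r subr0.
- move=> y Ay; apply: infle; exists 1, y; split=> //.
  by rewrite scale1r addNr sublinear0// mul1r sub0r.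
Qed.

(* A minimal sublinear functional is linear, by the previous lemma applied to
   a singleton. *)
Theorem hahn_banach p : sublinear p ->
  exists f : {linear V -> R^o}, forall x, f x <= p x.
Proof.
move=> sp.
pose S := {q : V -> R | sublinear q /\ forall x, q x <= p x}.
pose mk q sq qp : {classic S} :=
  exist (fun q => sublinear q /\ forall x, q x <= p x) q (conj sq qp).
(* The order is reversed, so that Zorn's lemma yields a minimal functional; the bound of a chain is
   its pointwise infimum. *)
pose ord (q1 q2 : {classic S}) := `[< forall x, sval q2 x <= sval q1 x >].
have [| | |[f [sf fp]] fmin] :=
  @ZL_preorder {classic S} (mk p sp (fun=> lexx _)) ord.
- by move=> q; apply/asboolP.
- move=> r s t /asboolP sr /asboolP ts; apply/asboolP => x.
  exact: le_trans (ts x) (sr x).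
- move=> H totH; have [[q0 Hq0]|H0] := pselect (H !=set0); last first.
    exists (mk p sp (fun=> lexx _)) => q Hq.
    by exfalso; apply: H0; exists q.
  pose E x := [set sval q x | q in H].
  have E0 x : E x !=set0 by exists (sval q0 x), q0.
  have Ehlb x : has_lbound (E x).
    exists (- p (- x)) => _ [q Hq <-]; have [sq qp] := svalP q.
    apply: le_trans (sublinear_geN x sq); by rewrite lerN2.
  have infle x r : E x r -> inf (E x) <= r by apply: ge_inf.
  have sE : sublinear (fun x => inf (E x)).
    split=> [x y|t x t0].
      rewrite -lerBlDr; apply: lb_le_inf => // _ [q1 Hq1 <-].
      rewrite lerBlDr -lerBlDl; apply: lb_le_inf => // _ [q2 Hq2 <-].
      rewrite lerBlDl.
      have [q [Hq q1q q2q]] : exists q : {classic S},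
          [/\ H q, sval q x <= sval q1 x & sval q y <= sval q2 y].
        by have [/asboolP h|/asboolP h] := totH _ _ Hq1 Hq2;
          [exists q2|exists q1].
      apply: (@le_trans _ _ (sval q (x + y))); first by apply: infle; exists q.
      have [[qD _] _] := svalP q.
      by apply: le_trans (qD x y) _; apply: lerD.
    rewrite -ler_pdivrMl//; apply: lb_le_inf => // _ [q Hq <-].
    rewrite ler_pdivrMl//; have [[_ qZ] _] := svalP q.
    apply: le_trans (qZ _ _ t0); by apply: infle; exists q.
  have Ep x : inf (E x) <= p x.
    apply: (@le_trans _ _ (sval q0 x)); first by apply: infle; exists q0.
    by have [_] := svalP q0; exact.
  exists (mk _ sE Ep) => q Hq; apply/asboolP => x /=.
  by apply: infle; exists q.
have {}fmin q : sublinear q -> (forall x, q x <= f x) -> forall x, f x <= q x.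
  move=> sq qf; have qp x : q x <= p x by exact: le_trans (qf x) (fp x).
  by have /asboolP := fmin (mk q sq qp) (introT (asboolP _) qf).
(* Minimality forces [f] to coincide with the functional [q] built from [A = [set v]], which
   satisfies [q (- v) <= - f v]. Oddness then gives additivity. *)
have fN v : f (- v) = - f v.
  apply/eqP; rewrite eq_le; apply/andP; split; last first.
    by have := sublinear_geN v sf; rewrite lerNl.
  have [||q [sq qf qv]] := @sublinear_inf f [set v] (f v) sf (ex_intro _ v erefl).
  - move=> _ _ t _ _ -> ->; rewrite -scalerDl addrC subrK scale1r//.
  - by move=> _ ->.
  by apply: le_trans (fmin q sq qf _) (qv _ erefl).
have fD x y : f (x + y) = f x + f y.
  apply/eqP; rewrite eq_le; have [fD _] := sf; rewrite fD/=.
  by have := fD (x + y) (- y); rewrite addrK fN; lra.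
have fL : linear (f : V -> R^o).
  move=> t x y; rewrite fD; congr (_ + _).
  have [t0|t0] := leP 0 t; first by rewrite sublinearZ.
  have nt0 : 0 <= - t by rewrite oppr_ge0 ltW.
  have := sublinearZ x sf nt0; rewrite scaleNr fN mulNr => /oppr_inj ->//.
pose m := GRing.isLinear.Build R V R^o _ (f : V -> R^o) fL.
pose g : {linear V -> R^o} := HB.pack (f : V -> R^o) m.
by exists g => x; exact: fp.
Qed.

End sublinear_theory.

(** * Functionals of norm one *)

Section dual_sphere_theory.
Context (R : realType) (X : normedModType R).
Implicit Types (x y v : X) (A : set X) (f g : {linear X -> R^o}).

Lemma dualZ f (t : R) x : f (t *: x) = t * f x :> R.
Proof. exact: linearZ. Qed.

Lemma dualB f x y : f (x - y) = f x - f y :> R.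
Proof. exact: linearB. Qed.

Lemma dualD f x y : f (x + y) = f x + f y :> R.
Proof. exact: linearD. Qed.

Lemma dual_sphereP f : (forall x, f x <= `|x|) ->
  (forall e, 0 < e -> exists2 y, y != 0 & (1 - e) * `|y| <= f y) ->
  dual_sphere f.
Proof.
move=> f1 fsup.
have fabs x : `|f x| <= `|x|.
  by rewrite ler_norml f1 andbT lerNl -linearN -normrN; exact: f1.
split.
  apply/linear_bounded_continuous.
  exists 1; split; first exact: real1.
  move=> M M1; near=> x; apply: le_trans (fabs x) _; apply: le_trans (ltW M1).
  near: x; apply/nbhs_ballP; exists 1 => //= x.
  by rewrite -ball_normE /= sub0r normrN => /ltW.
apply/eqP; rewrite eq_le; apply/andP; split.
  by apply: ge_ereal_sup => _ [x x1 <-]; rewrite lee_fin (le_trans (fabs x)).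
apply/lee_addgt0Pr => e e0; have [y y0 fy] := fsup _ e0.
have ny : 0 < `|y| by rewrite normr_gt0.
apply: (@le_trans _ _ (`|f (`|y|^-1 *: y)|%:E + e%:E)%E).
  rewrite -EFinD lee_fin -lerBlDr (le_trans _ (ler_norm _))//.
  by rewrite linearZ/= ler_pdivlMl// mulrC.
apply: leeD => //; apply: ereal_sup_ubound.
exists (`|y|^-1 *: y) => //; rewrite /unit_ball/= normrZ normfV normr_id.
by rewrite mulVf// gt_eqF.
Unshelve. all: by end_near. Qed.

Lemma normr_sublinear : sublinear (fun x : X => `|x|).
Proof.
split=> [x y|t x t0]; first exact: ler_normD.
by rewrite normrZ gtr0_norm.
Qed.

(** The construction is run with the exact distance [D] from [0] to [A] instead of [d]: points of
    [A] of norm close to [D] then show that [f] has norm exactly one. *)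
Lemma separation A (d : R) : A !=set0 -> segment_closed A -> 0 < d ->
    (forall y, A y -> d <= `|y|) ->
  exists f, [/\ dual_sphere f, forall x, f x <= `|x| &
    forall y, A y -> d <= f y].
Proof.
move=> [y0 Ay0] cA d0 dA.
pose E := [set `|y| | y in A]; pose D := inf E.
have E0 : E !=set0 by exists `|y0|, y0.
have Elb : has_lbound E by exists d => _ [y Ay <-]; exact: dA.
have dD : d <= D by apply: lb_le_inf => // _ [y Ay <-]; exact: dA.
have DA y : A y -> D <= `|y| by move=> Ay; apply: ge_inf => //; exists y.
have [q [sq q1 qA]] := sublinear_inf normr_sublinear (ex_intro _ y0 Ay0) cA DA.
have [f fq] := hahn_banach sq.
have fA y : A y -> D <= f y.
  by move=> Ay; rewrite -lerN2 -linearN; exact: le_trans (fq _) (qA _ Ay).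
have f1 x : f x <= `|x| by exact: le_trans (fq _) (q1 _).
exists f; split=> //; last by move=> y Ay; exact: le_trans (fA _ Ay).
apply: dual_sphereP => // e e0.
have D0 : 0 < D by exact: lt_le_trans dD.
have eD : 0 < e * D by rewrite mulr_gt0.
have [_ [y Ay <-] yD] := inf_adherent eD (conj E0 Elb).
exists y; first by rewrite -normr_gt0 (lt_le_trans D0)// DA.
apply: le_trans (fA _ Ay); have := DA _ Ay; have : e * D <= e * `|y|.
  by rewrite ler_pM2l// DA.
by rewrite -/D in yD; lra.
Qed.

Lemma norming v : 0 < `|v| ->
  exists f, [/\ dual_sphere f, forall x, f x <= `|x| & `|v| <= f v].
Proof.
move=> v0; have [||_ ->//|f [fS f1 fv]] := @separation [set v] `|v| _ _ v0.
- by exists v.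
- by move=> _ _ t _ _ -> ->; rewrite -scalerDl addrC subrK scale1r.
by exists f; split=> //; exact: fv.
Qed.

(** The hypothesis in the form used below: a single vector [v] witnesses the distance between [f]
    and [g], and slices are taken in a ball of radius [r]. *)
Lemma noncreasy_scaled (eps : R) : uniformly_noncreasy X -> 0 < eps ->
  exists2 dl : R, 0 < dl & forall f g (r : R) v x y,
    dual_sphere f -> dual_sphere g -> 0 < `|v| -> eps * `|v| <= f v - g v ->
    0 < r -> `|x| <= r -> `|y| <= r ->
    (1 - dl) * r <= f x -> (1 - dl) * r <= f y ->
    (1 - dl) * r <= g x -> (1 - dl) * r <= g y -> `|x - y| <= eps * r.
Proof.
move=> hX e0; have [dl dl0 H] := hX _ e0; exists dl => // f g r v x y fS gS v0.
move=> fgv r0 xr yr fx fy gx gy.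
have fg : (eps%:E <= dual_norm (f \- g)%R)%E.
  apply: (@le_trans _ _ (`|(f \- g)%R (`|v|^-1 *: v)|%:E)).
    rewrite lee_fin (le_trans _ (ler_norm _))//=.
    suff -> : f (`|v|^-1 *: v) - g (`|v|^-1 *: v) = `|v|^-1 * (f v - g v).
      by rewrite ler_pdivlMl// mulrC.
    by rewrite !dualZ mulrBr.
  apply: ereal_sup_ubound; exists (`|v|^-1 *: v) => //.
  by rewrite /unit_ball/= normrZ normfV normr_id mulVf// gt_eqF.
have := H _ _ fS gS fg; rewrite /diam ge_max => /andP[_ diamS].
have slice z : `|z| <= r -> (1 - dl) * r <= f z -> (1 - dl) * r <= g z ->
    slice2 f g dl (r^-1 *: z).
  move=> zr fz gz; split.
  - by rewrite /unit_ball/= normrZ gtr0_norm ?invr_gt0// ler_pdivrMl// mulr1.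
  - by rewrite linearZ/= ler_pdivlMl// mulrC.
  - by rewrite linearZ/= ler_pdivlMl// mulrC.
have := le_trans (ereal_sup_ubound _) diamS.
move=> /(_ `|r^-1 *: x - r^-1 *: y|%:E).
have -> : `|r^-1 *: x - r^-1 *: y| = r^-1 * `|x - y|.
  by rewrite -scalerBr normrZ gtr0_norm ?invr_gt0.
rewrite lee_fin ler_pdivrMl// (mulrC r); apply.
exists (r^-1 *: x); first exact: slice.
exists (r^-1 *: y); first exact: slice.
by rewrite -scalerBr normrZ gtr0_norm ?invr_gt0.
Qed.

End dual_sphere_theory.

(** * Configurations excluded by noncreasiness *)

Section noncreasy_configurations.
Context (R : realType) (X : normedModType R).
Hypothesis hX : uniformly_noncreasy X.
Implicit Types (x y u w p : X) (r e : R).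

(* The points [2 (w - x)] and [2 (y - w)] lie in the slice of two functionals
   nearly norming [y - x], one nearly constant on [x], [u], the other on
   [y], [u]. *)
Lemma metric_midpoint_unique eps : 0 < eps ->
  exists2 e : R, 0 < e & forall r x y u w, 0 < r ->
    `|x - y| <= (1 + e) * r -> `|x - u| <= (1 + e) * r ->
    `|y - u| <= (1 + e) * r ->
    (1 - e) * r <= `|y - 2^-1 *: (x + u)| ->
    (1 - e) * r <= `|x - 2^-1 *: (y + u)| ->
    `|w - x| <= (1 + e) * r / 2 -> `|w - y| <= (1 + e) * r / 2 ->
    `|w - 2^-1 *: (x + y)| <= eps * r.
Proof.
move=> eps0; pose eps' := Num.min eps 2^-1.
have eps'0 : 0 < eps' by rewrite lt_min eps0 invr_gt0 ltr0n.
have [eps'1 eps'2] : eps' <= eps /\ eps' <= 2^-1.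
  by split; rewrite ge_min lexx ?orbT.
have [dl dl0 H] := noncreasy_scaled hX eps'0.
(* The functionals lose at most [7 * s], with [s = e * r], while the slice of radius [r + s]
   tolerates [dl * (r + s) - s]; this is ensured by [dl / 16]. *)
pose e := Num.min (dl / 16) 32^-1.
have e0 : 0 < e by rewrite lt_min divr_gt0//= invr_gt0 ltr0n.
have [e1 e2] : e <= dl / 16 /\ e <= 32^-1 by split; rewrite ge_min lexx ?orbT.
exists e => // r x y u w r0 xy xu yu yxu xyu wx wy.
pose s := e * r.
have s0 : 0 < s by rewrite mulr_gt0.
have s1 : s <= dl * r / 16 by rewrite mulrAC ler_pM2r.
have s2 : s <= r / 32 by rewrite (mulrC r) ler_pM2r.
have ds : 0 < dl * s by rewrite mulr_gt0.
have ees : eps' * s <= eps' * r / 32 by rewrite -mulrA ler_pM2l.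
have er : eps' * r <= eps * r by rewrite ler_pM2r.
have er0 : 0 < eps' * r by rewrite mulr_gt0.
have er2 : eps' * r <= r / 2 by rewrite mulrC ler_pM2l.
have Er : (1 - e) * r = r - s by rewrite /s; ring.
have yxu0 : 0 < `|y - 2^-1 *: (x + u)|.
  by rewrite (lt_le_trans _ yxu)// Er; lra.
have xyu0 : 0 < `|2^-1 *: (y + u) - x|.
  by rewrite distrC (lt_le_trans _ xyu)// Er; lra.
have [f [fS f1 fv]] := norming yxu0.
have [g [gS g1 gv]] := norming xyu0.
rewrite distrC in xyu.
have fyxu : (1 - e) * r <= f y - (f x + f u) / 2.
  by rewrite (le_trans (le_trans yxu fv))// dualB dualZ dualD; clear; lra.
have gyxu : (1 - e) * r <= (g y + g u) / 2 - g x.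
  by rewrite (le_trans (le_trans xyu gv))// dualB dualZ dualD; clear; lra.
have fb z z' b : `|z - z'| <= b -> f z - f z' <= b.
  by rewrite -dualB; apply: le_trans.
have gb z z' b : `|z - z'| <= b -> g z - g z' <= b.
  by rewrite -dualB; apply: le_trans.
have Er' : (1 + e) * r = r + s by rewrite /s; ring.
rewrite ?Er ?Er' in xy xu yu wx wy fyxu gyxu.
have yx : `|y - x| <= r + s by rewrite distrC.
have ux : `|u - x| <= r + s by rewrite distrC.
have yw : `|y - w| <= (r + s) / 2 by rewrite distrC.
have [fyx gyx] := (fb _ _ _ yx, gb _ _ _ yx).
have [fyu gux] := (fb _ _ _ yu, gb _ _ _ ux).
have [fyw gyw] := (fb _ _ _ yw, gb _ _ _ yw).
have [fwx gwx] := (fb _ _ _ wx, gb _ _ _ wx).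
(* An average of two increments is at least [r - s] and each is at most [r + s], so each is at least
   [r - 3 * s]. Thus [g] grows by about [r] from [x] to [u], where [f] is nearly constant. *)
have gyx' : r - 3 * s <= g y - g x by clear -gyxu gux; lra.
have {}gux : r - 3 * s <= g u - g x by clear -gyxu gyx; lra.
have fux : f u - f x <= 4 * s by clear -fyxu fyx fyu; lra.
have fyx' : r - 3 * s <= f y - f x by clear -fyxu fyx fyu; lra.
have ux0 : 0 < `|u - x|.
  rewrite (lt_le_trans _ (g1 _))// dualB (lt_le_trans _ gux)//.
  by clear -s2 r0; lra.
have epsux : eps' * `|u - x| <= g (u - x) - f (u - x).
  rewrite (dualB g) (dualB f).
  have : eps' * `|u - x| <= eps' * (r + s) by rewrite ler_pM2l.
  by clear -ees er2 gux fux s2 r0; lra.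
have slice (a : R) : r - 7 * s <= a -> (1 - dl) * (r + s) <= a.
  by clear -s1 s0 ds; lra.
have : `|(2 : R) *: (w - x) - (2 : R) *: (y - w)| <= eps' * (r + s).
  apply: (H g f (r + s) (u - x)) => //;
    rewrite ?(dualZ f) ?(dualZ g) ?(dualB f) ?(dualB g) ?normrZ ?ger0_norm//.
  - by clear -s0 r0; lra.
  - by clear -wx; lra.
  - by clear -yw; lra.
  - by apply: slice; clear -gyx' gyw; lra.
  - by apply: slice; clear -gyx' gwx; lra.
  - by apply: slice; clear -fyx' fyw; lra.
  - by apply: slice; clear -fyx' fwx; lra.
have -> : (2 : R) *: (w - x) - (2 : R) *: (y - w) =
    (4 : R) *: (w - 2^-1 *: (x + y)).
  have -> : (4 : R) = 2 * 2 by rewrite -natrM.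
  rewrite -scalerBr -scalerA; congr (_ *: _).
  rewrite scalerBr scalerA divff// scale1r scaler_nat mulr2n.
  by rewrite opprB addrACA -opprD (addrC x).
rewrite normrZ ger0_norm//; clear -ees er er0; lra.
Qed.

(* [h] separates the midpoint of [x], [y] from that of [p], [q], and [g]
   separates [p] from the other three points; they differ on [q - p], while
   [x - p] and [y - p] lie in both slices. *)
Lemma quadruple_contradiction :
  exists2 e : R, 0 < e & forall r x y p (q : X), 0 < r ->
    `|x - y| <= (1 + e) * r -> `|x - p| <= (1 + e) * r ->
    `|x - q| <= (1 + e) * r -> `|y - p| <= (1 + e) * r ->
    `|y - q| <= (1 + e) * r -> `|p - q| <= (1 + e) * r ->
    (1 - e) * r <= `|2^-1 *: (x + y) - 2^-1 *: (p + q)| ->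
    (1 - e) * r <= `|p - 3^-1 *: (x + y + q)| -> `|x - y| < (1 - e) * r.
Proof.
have h0 : (0 : R) < 2^-1 by rewrite invr_gt0.
have [dl dl0 H] := noncreasy_scaled hX h0.
pose e := Num.min (dl / 16) 64^-1.
have e0 : 0 < e by rewrite lt_min divr_gt0//= invr_gt0 ltr0n.
have [e1 e2] : e <= dl / 16 /\ e <= 64^-1 by split; rewrite ge_min lexx ?orbT.
exists e => // r x y p q r0 xy xp xq yp yq pq Hh Hg.
pose s := e * r.
have s0 : 0 < s by rewrite mulr_gt0.
have s1 : s <= dl * r / 16 by rewrite mulrAC ler_pM2r.
have s2 : s <= r / 64 by rewrite (mulrC r) ler_pM2r.
have ds : 0 < dl * s by rewrite mulr_gt0.
have Er : (1 - e) * r = r - s by rewrite /s; ring.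
have Er' : (1 + e) * r = r + s by rewrite /s; ring.
rewrite ?Er ?Er' in xy xp xq yp yq pq Hh Hg *.
have h1 : 0 < `|2^-1 *: (x + y) - 2^-1 *: (p + q)|.
  by rewrite (lt_le_trans _ Hh)//; lra.
rewrite distrC in Hg.
have g1 : 0 < `|3^-1 *: (x + y + q) - p| by rewrite (lt_le_trans _ Hg)//; lra.
have [h [hS h1' hv]] := norming h1.
have [g [gS g1' gv]] := norming g1.
have {}hv : r - s <= (h x + h y) / 2 - (h p + h q) / 2.
  rewrite (le_trans (le_trans Hh hv))//.
  by rewrite (dualB h) !(dualZ h) !(dualD h); clear; lra.
have {}gv : r - s <= (g x + g y + g q) / 3 - g p.
  rewrite (le_trans (le_trans Hg gv))//.
  by rewrite (dualB g) !(dualZ g) !(dualD g); clear; lra.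
have hb z z' b : `|z - z'| <= b -> h z - h z' <= b.
  by rewrite -dualB; apply: le_trans.
have gb z z' b : `|z - z'| <= b -> g z - g z' <= b.
  by rewrite -dualB; apply: le_trans.
have qp : `|q - p| <= r + s by rewrite distrC.
have [hxp hxq] := (hb _ _ _ xp, hb _ _ _ xq).
have [hyp hyq] := (hb _ _ _ yp, hb _ _ _ yq).
have [[gxp gyp] gqp] := ((gb _ _ _ xp, gb _ _ _ yp), gb _ _ _ qp).
(* Three increments of [g] from [p] sum to at least [3 * (r - s)], and two of them are at most
   [r + s]. *)
have gqp' : r - 5 * s <= g q - g p by clear -gv gxp gyp; lra.
have hqp : h q - h p <= 8 * s by clear -hv hxp hyp hyq hxq; lra.
have qp0 : 0 < `|q - p|.
  rewrite (lt_le_trans _ (g1' _))// dualB (lt_le_trans _ gqp')//.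
  by clear -s2 r0; lra.
have slice (a : R) : r - 7 * s <= a -> (1 - dl) * (r + s) <= a.
  by clear -s1 s0 ds; lra.
apply: (@le_lt_trans _ _ (2^-1 * (r + s))); last by clear -s2 r0; lra.
have -> : x - y = (x - p) - (y - p) by rewrite opprB addrA subrK.
apply: (H g h (r + s) (q - p)) => //;
  rewrite ?(dualB h) ?(dualB g)//.
- by clear -gqp' hqp qp s2 r0; lra.
- by clear -s0 r0; lra.
- by apply: slice; clear -gv gyp gqp s0; lra.
- by apply: slice; clear -gv gxp gqp s0; lra.
- by apply: slice; clear -hv hxp hyp hyq hxq; lra.
- by apply: slice; clear -hv hxp hyp hyq hxq; lra.
Qed.

End noncreasy_configurations.

(** * Weak compactness *)

(* For an ultrafilter these are the weak limits. *)
Definition weak_adherence (R : realType) (X : normedModType R)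
    (F : set_system X) : set X :=
  [set c | forall A, closed A -> segment_closed A -> F A -> A c].

Section weak_compactness.
Context (R : realType) (X : completeNormedModType R).
Hypothesis hX : uniformly_noncreasy X.
Implicit Types (F : set_system X) (p c : X) (t : R).

Let meets F p t :=
  forall A, closed A -> segment_closed A -> F A -> exists2 x, A x & `|x - p| <= t.

Let separation_at A p (d : R) : A !=set0 -> segment_closed A -> 0 < d ->
    (forall y, A y -> d < `|y - p|) ->
  exists f : {linear X -> R^o}, [/\ dual_sphere f, forall x, f x <= `|x| &
    forall y, A y -> d <= f y - f p].
Proof.
move=> [y0 Ay0] cA d0 dA.
have [|||f [fS f1 fA]] := @separation _ _ [set y - p | y in A] _ _ _ d0.
- by exists (y0 - p), y0.
- move=> _ _ t t0 t1 [x Ax <-] [y Ay <-].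
  exists (t *: x + (1 - t) *: y); first exact: cA.
  by rewrite !scalerBr addrACA -opprD -scalerDl addrC subrKC scale1r addrC.
- by move=> _ [y Ay <-]; exact/ltW/dA.
by exists f; split=> // y Ay; rewrite -dualB; apply: fA; exists y.
Qed.

(* If no [p'] works, then a functional [f] separating a member of [F] from [p],
   and a functional [f1] separating a member from a point [p1] slightly closer
   to it, are far apart, but both nearly attain their norms on all points of
   the filter near [p], so that these form a set of small diameter. *)
Let meets_contract : exists al : R, [/\ 0 < al, al < 1 & forall F p t,
  ProperFilter F -> 0 < t -> meets F p t ->
  exists2 p', `|p' - p| <= t & meets F p' (al * t)].
Proof.
have h0 : (0 : R) < 2^-1 by rewrite invr_gt0.
have [dl dl0 H] := noncreasy_scaled hX h0.
pose tau := Num.min (dl / 2) 4^-1.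
have tau0 : 0 < tau by rewrite lt_min divr_gt0//= invr_gt0 ltr0n.
have [tau1 tau2] : tau <= dl / 2 /\ tau <= 4^-1.
  by split; rewrite ge_min lexx ?orbT.
have tau3 : tau * tau <= 4^-1 * tau by rewrite ler_pM2r.
have tau4 : 0 < tau * tau by rewrite mulr_gt0.
pose al := 1 - tau * tau.
have [al0 al1] : 0 < al /\ al < 1 by rewrite /al; split; lra.
exists al; split=> // F p t FF t0 mF; apply: contrapT => nex.
have alt0 : 0 < al * t by rewrite mulr_gt0.
have far p' : `|p' - p| <= t -> exists A, [/\ closed A, segment_closed A, F A &
    forall y, A y -> al * t < `|y - p'|].
  move=> pp'; apply: contrapT => nA; apply: nex; exists p' => // A clA cA FA.
  apply: contrapT => nx; apply: nA; exists A; split=> // y Ay.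
  by rewrite ltNge; apply/negP => yp'; apply: nx; exists y.
have [A0 [clA0 cA0 FA0 A0p]] := far p ltac:(by rewrite subrr normr0 ltW).
have [f [fS f1 fA0]] := separation_at (filter_ex FA0) cA0 alt0 A0p.
have [x1 A0x1 x1p] := mF _ clA0 cA0 FA0.
pose p1 := p + tau *: (x1 - p).
have p1p : `|p1 - p| <= t.
  rewrite /p1 addrC addKr normrZ gtr0_norm// (le_trans _ x1p)//.
  by rewrite ler_piMl//; lra.
have [A1 [clA1 cA1 FA1 A1p]] := far p1 p1p.
have [g [gS g1 gA1]] := separation_at (filter_ex FA1) cA1 alt0 A1p.
have meet2 A : closed A -> segment_closed A -> F A ->
    exists x, [/\ A x, A0 x, A1 x & `|x - p| <= t].
  move=> clA cA FA.
  have [|||x [Ax [A0x A1x]] xp] := mF (A `&` (A0 `&` A1)).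
  - by apply: closedI => //; exact: closedI.
  - move=> x y s s0 s1 [Ax [A0x A1x]] [Ay [A0y A1y]].
    by split; [exact: cA|split; [exact: cA0|exact: cA1]].
  - by apply: filterI => //; exact: filterI.
  by exists x.
have [x2 [_ A0x2 A1x2 x2p]] := meet2 setT closedT ltac:(by []) filterT.
(* [x2] and [x3] will lie in both slices, although [A3] keeps them more than [al * t] apart. *)
have [A3 [clA3 cA3 FA3 A3x2]] := far x2 x2p.
have [x3 [A3x3 A0x3 A1x3 x3p]] := meet2 A3 clA3 cA3 FA3.
have gp1 : g p1 = g p + tau * (g x1 - g p) by rewrite dualD dualZ dualB.
have tt0 : 0 < tau * tau * t by rewrite mulr_gt0.
have t1 : tau * t <= dl / 2 * t by rewrite ler_pM2r.
have t2 : tau * t <= 4^-1 * t by rewrite ler_pM2r.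
have t3 : tau * tau * t <= 4^-1 * tau * t by rewrite ler_pM2r.
have altE : al * t = t - tau * tau * t by rewrite /al; ring.
have fslice y : A0 y -> (1 - dl) * t <= f (y - p).
  move=> A0y; rewrite dualB (le_trans _ (fA0 _ A0y))// altE.
  by clear -t1 t2 t3 t0 dl0 tau0; nra.
have gx1p : - t <= g x1 - g p.
  rewrite lerNl opprB -dualB (le_trans (g1 _))// distrC//.
have tgx1p : - (tau * t) <= tau * (g x1 - g p).
  by rewrite -mulrN ler_pM2l.
have gslice y : A1 y -> (1 - dl) * t <= g (y - p).
  move=> A1y; rewrite dualB; have := gA1 _ A1y; rewrite gp1 altE.
  by clear -t1 t2 t3 t0 dl0 tau0 tgx1p; nra.
(* As [x2] is within [t] of [p], the functional [g] gains at most [tau * tau * t] from [p] to [p1];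
   dividing by [tau] leaves [tau * t], whence the quadratic choice of [al]. So [g] is small on
   [x1 - p], where [f] is nearly [t]. *)
have gx1 : g x1 - g p <= tau * t.
  have gx2p : g x2 - g p <= t by rewrite -dualB (le_trans (g1 _)).
  have := gA1 _ A1x2; rewrite gp1 altE => gx2.
  rewrite -(ler_pM2l tau0) mulrA.
  by clear -gx2 gx2p; lra.
have fx1 := fA0 _ A0x1.
have x1p0 : 0 < `|x1 - p|.
  by rewrite (lt_le_trans _ (f1 _))// dualB (lt_le_trans _ fx1).
have := A3x2 _ A3x3; rewrite ltNge => /negP; apply.
have -> : x3 - x2 = (x3 - p) - (x2 - p) by rewrite opprB addrA subrK.
apply: (@le_trans _ _ (2^-1 * t)); last first.
  by rewrite altE; clear -t2 t3 t0; lra.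
apply: (H f g t (x1 - p)) => //; try (exact: fslice); try exact: gslice.
rewrite (dualB f) (dualB g); rewrite altE in fx1.
by clear -fx1 gx1 t2 t3 x1p t0; lra.
Qed.

(** Iterating [meets_contract] from [0] gives centers with geometrically decreasing steps and radii.
    A closed convex member of [F] has points within these radii of the centers, so it contains their
    limit. *)
Theorem weak_adherence_nonempty F (B : set X) (M : R) : ProperFilter F ->
  F B -> (forall x, B x -> `|x| <= M) -> weak_adherence F !=set0.
Proof.
move=> FF FB BM; have [al [al0 al1 contr]] := meets_contract.
pose t0 := `|M| + 1.
have t0gt0 : 0 < t0 by rewrite ltr_wpDl.
have m0 : meets F 0 t0.
  move=> A _ _ FA; have [x [Ax Bx]] := filter_ex (filterI FA FB).
  exists x => //; rewrite subr0 (le_trans (BM _ Bx))//.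
  by rewrite (le_trans (ler_norm _))// lerDl.
have /choice[step stepP] : forall q : X * R, exists p',
    0 < q.2 -> meets F q.1 q.2 ->
    `|p' - q.1| <= q.2 /\ meets F p' (al * q.2).
  move=> [p t] /=; have [[t_gt0 mt]|nm] := pselect (0 < t /\ meets F p t).
    by have [p' ? ?] := contr _ _ _ FF t_gt0 mt; exists p'.
  by exists p => t_gt0 mt; exfalso; apply: nm.
pose fix q n := if n is n'.+1 then (step (q n'), al * (q n').2) else (0 : X, t0).
pose p n := (q n).1.
have q2 n : (q n).2 = al ^+ n * t0.
  by elim: n => [|n IH]; rewrite ?expr0 ?mul1r//= IH exprS mulrA.
have q2gt0 n : 0 < (q n).2 by rewrite q2 mulr_gt0// exprn_gt0.
have mq n : meets F (p n) (q n).2.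
  by elim: n => [//|n IH]; have [_] := stepP (q n) (q2gt0 n) IH.
have dq n : `|p n.+1 - p n| <= (q n).2.
  by have [] := stepP (q n) (q2gt0 n) (mq n).
have dqk n k : `|p (n + k)%N - p n| <= (1 - al ^+ k) / (1 - al) * (q n).2.
  elim: k => [|k IH]; first by rewrite addn0 subrr normr0 expr0 subrr !mul0r.
  rewrite addnS.
  have -> : p (n + k).+1 - p n = (p (n + k).+1 - p (n + k)%N) + (p (n + k)%N - p n).
    by rewrite addrA subrK.
  apply: le_trans (ler_normD _ _) _.
  apply: le_trans (lerD (dq _) IH) _; rewrite !q2 exprD exprSr le_eqVlt.
  by apply/orP; left; apply/eqP; field; rewrite subr_eq0 gt_eqF.
have alc : (fun n => al ^+ n * t0) @ \oo --> (0 : R).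
  rewrite -[X in _ --> X](mul0r t0); apply: cvgM (cvg_cst _).
  by apply: cvg_expr; rewrite gtr0_norm.
have pc : cvgn p.
  apply: cauchy_cvg; apply: cauchy_exP => e e0.
  have e'0 : 0 < e * (1 - al) by rewrite mulr_gt0// subr_gt0.
  have /cvgr0Pnorm_lt /(_ _ e'0) [N _ NP] := alc.
  exists (p N); exists N => // n /= Nn.
  rewrite -ball_normE /= -(subnKC Nn) distrC.
  apply: le_lt_trans (dqk _ _) _; rewrite mulrAC ltr_pdivrMr ?subr_gt0//.
  have := NP N (leqnn N); rewrite /= -q2 gtr0_norm//; apply: le_lt_trans.
  rewrite ler_piMl//; first exact: ltW.
  by rewrite gerBl exprn_ge0// ltW.
exists (limn p) => A clA cA FA.
have /choice[x xP] : forall n, exists x, A x /\ `|x - p n| <= al ^+ n * t0.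
  by move=> n; have [x ? xp] := mq n A clA cA FA; exists x; rewrite -q2.
have xc : x @ \oo --> limn p.
  have -> : x = (fun n => (x n - p n) + p n) by apply/funext => n; rewrite subrK.
  rewrite -[X in _ --> X]add0r; apply: cvgD pc.
  apply/norm_cvg0P.
  apply: (@squeeze_cvgr _ _ _ _ (fun=> 0) (fun n => al ^+ n * t0)) => //.
    by near=> n; rewrite normr_ge0 /=; have [] := xP n.
  exact: cvg_cst.
by apply: (closed_cvg _ clA _ _ xc); apply: nearW => n; have [] := xP n.
Unshelve. all: by end_near. Qed.

End weak_compactness.

(** * Iterated filters and asymptotic balls *)

(** The Fubini product, for iterated limits: the second index is taken far out depending on the
    first. *)
Definition filter_curry (I J : Type) (F : set_system I) (G : set_system J) :
  set_system (I * J) := [set B | F [set i | G [set j | B (i, j)]]].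

Section filter_curry.
Context (I J : Type) (F : set_system I) (G : set_system J).

Global Instance filter_curry_filter {FF : Filter F} {FG : Filter G} :
  Filter (filter_curry F G).
Proof.
split=> [|A B FA FB|A B AB FA].
- by apply: (@filterE _ F) => i; exact: filterT.
- by apply: (@filterS2 _ F) FA FB => i; exact: filterI.
- by apply: (@filterS _ F) FA => i; apply: filterS => j; exact: AB.
Qed.

Global Instance filter_curry_proper {FF : ProperFilter F} {FG : ProperFilter G} :
  ProperFilter (filter_curry F G).
Proof.
split; last exact: filter_curry_filter.
by move=> /(@filter_ex _ F)[i /(@filter_ex _ G)[]].
Qed.

End filter_curry.

Lemma ultra_near_not (J : Type) (U : set_system J) (P : set J) :
  UltraFilter U -> ~ U P -> U (~` P).
Proof. by move=> UU nUP; have [] := in_ultra_setVsetC P UU. Qed.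

Section convex_sets.
Context (R : realType) (X : normedModType R).
Implicit Types (A : set X) (x p q : X) (a t : R).

Lemma scale_half_double x : 2^-1 *: (x + x) = x.
Proof. by rewrite scalerDr -scalerDl -div1r -splitr scale1r. Qed.

Lemma closed_affine_preimage A a p : closed A -> closed [set q | A (a *: q + p)].
Proof.
apply: preimage_closed => q _.
by apply: cvgD; [exact: scaler_continuous|exact: cvg_cst].
Qed.

Lemma segment_affine_preimage A a p :
  segment_closed A -> segment_closed [set q | A (a *: q + p)].
Proof.
move=> cA x y t t0 t1 /= Ax Ay; have := cA _ _ _ t0 t1 Ax Ay.
rewrite !scalerDr addrACA -scalerDl addrC subrKC scale1r addrC.
by rewrite !scalerA ![_ * a]mulrC -!scalerA.
Qed.

Lemma segment_midpoint A x y : segment_closed A -> A x -> A y ->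
  A (2^-1 *: (x + y)).
Proof.
move=> cA Ax Ay; have := @cA x y 2^-1 _ _ Ax Ay.
have -> : 1 - 2^-1 = 2^-1 :> R by lra.
by rewrite -scalerDr; apply; lra.
Qed.

(* The sublevel set at [t] of the limit superior of [`|w - p|] along [F]. *)
Definition asymptotic_ball (F : set_system X) t : set X :=
  [set p | forall e, 0 < e -> F [set w | `|w - p| <= t + e]].

Context (F : set_system X) {FF : Filter F}.

Lemma asymptotic_ball_closed t : closed (asymptotic_ball F t).
Proof.
move=> p clp e e0.
have e20 : 0 < e / 2 by rewrite divr_gt0.
have [q [bq]] := clp _ (nbhsx_ballx p _ e20).
rewrite -ball_normE /= distrC => /ltW pq.
apply: filterS (bq _ e20) => w /= wq.
have -> : w - p = (w - q) + (q - p) by rewrite addrA subrK.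
by rewrite (le_trans (ler_normD _ _))//; lra.
Qed.

Lemma asymptotic_ball_segment t : segment_closed (asymptotic_ball F t).
Proof.
move=> p q s s0 s1 bp bq e e0.
apply: filterS2 (bp _ e0) (bq _ e0) => w /= wp wq.
have -> : w - (s *: p + (1 - s) *: q) = s *: (w - p) + (1 - s) *: (w - q).
  rewrite !scalerBr addrACA -opprD -scalerDl (addrC s) subrK scale1r//.
rewrite (le_trans (ler_normD _ _))// !normrZ !ger0_norm ?subr_ge0//.
have s1' : 0 <= 1 - s by rewrite subr_ge0.
by have := ler_wpM2l s0 wp; have := ler_wpM2l s1' wq; lra.
Qed.

Lemma asymptotic_ball_le t t' : t <= t' ->
  asymptotic_ball F t `<=` asymptotic_ball F t'.
Proof.
move=> tt' p bp e e0; apply: filterS (bp _ e0) => w /= wp.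
by rewrite (le_trans wp)// lerD2r.
Qed.

Lemma asymptotic_ball_inf t p :
  (forall e, 0 < e -> asymptotic_ball F (t + e) p) -> asymptotic_ball F t p.
Proof.
move=> H e e0; have e20 : 0 < e / 2 by rewrite divr_gt0.
apply: filterS (H _ e20 _ e20) => w /= wp.
by rewrite (le_trans wp)//; lra.
Qed.

End convex_sets.

Section closed_balls.
Context (R : realType) (X : normedModType R).
Implicit Types (p : X) (t : R).

(** A ball is the asymptotic ball of a constant, which gives its closedness and convexity at
    once. *)
Let norm_ballE p t :
  [set q : X | `|p - q| <= t] = asymptotic_ball (globally [set p]) t.
Proof.
apply/seteqP; split=> q /= pq.
  by move=> e e0 _ ->/=; rewrite (le_trans pq)// lerDl ltW.
by apply/ler_addgt0Pr => e e0; exact: (pq e e0 p erefl).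
Qed.

Lemma norm_ball_closed p t : closed [set q : X | `|p - q| <= t].
Proof. by rewrite norm_ballE; exact: asymptotic_ball_closed. Qed.

Lemma norm_ball_segment p t : segment_closed [set q : X | `|p - q| <= t].
Proof. by rewrite norm_ballE; exact: asymptotic_ball_segment. Qed.

End closed_balls.

(** * Minimal weakly invariant sets *)

Section asymptotically_nonexpansive.
Context (R : realType) (X : completeNormedModType R).
Hypothesis hX : uniformly_noncreasy X.
Variables (C : set X) (T : X -> X) (M : R).
Hypotheses (C0 : C !=set0) (clC : closed C) (cC : segment_closed C).
Hypothesis CM : forall x, C x -> `|x| <= M.
Hypothesis TC : forall x, C x -> C (T x).
Hypothesis hT : forall e, 0 < e -> \forall n \near \oo, forall x y, C x -> C y ->
  `|iter n T x - iter n T y| <= `|x - y| + e.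
Implicit Types (p q c : X) (t e : R).

Let orbit q : nat -> X := fun n => iter n T q.

Lemma iterC q n : C q -> C (orbit q n).
Proof. by move=> Cq; elim: n => //= n; exact: TC. Qed.

(** Weak limits of orbits replace invariance under [T], since asymptotic balls are preserved by
    [T^n] only up to an error that vanishes as [n] grows. *)
Definition weakly_invariant (A : set X) := [/\ closed A, segment_closed A,
  A `<=` C, A !=set0 & forall q, A q -> weak_adherence (orbit q @ \oo) `<=` A].

Lemma weak_adherenceS (F G : set_system X) : F `<=` G ->
  weak_adherence G `<=` weak_adherence F.
Proof. by move=> FG c Gc A clA cA FA; apply: Gc => //; exact: FG. Qed.

(** By Zorn's lemma: a chain generates a proper filter containing [C], and a weak adherence point of
    that filter lies in every member of the chain. *)
Lemma minimal_weakly_invariant : exists K, weakly_invariant K /\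
  forall A, weakly_invariant A -> A `<=` K -> K `<=` A.
Proof.
have iC : weakly_invariant C.
  split=> // q Cq c; apply=> //.
  by exists 0%N => // n _; exact: iterC.
pose S := {A : set X | weakly_invariant A}.
pose ord (A B : {classic S}) := `[< sval B `<=` sval A >].
have [| | |[K iK] Kmin] := @ZL_preorder {classic S} (exist _ C iC) ord.
- by move=> A; exact/asboolP.
- by move=> A B D /asboolP BA /asboolP DB; apply/asboolP; exact: subset_trans BA.
- move=> H totH; have [[A0 HA0]|H0] := pselect (H !=set0); last first.
    exists (exist _ C iC) => A HA; exfalso; apply: H0; by exists A.
  pose F := filter_from H (fun A => sval A).
  have FF : ProperFilter F.
    apply: filter_from_proper; last by move=> A _; have [] := svalP A.
    apply: filter_from_filter; first by exists A0.
    move=> A B HA HB; have [/asboolP AB|/asboolP BA] := totH _ _ HA HB.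
      by exists B => // x Bx; split=> //; exact: AB.
    by exists A => // x Ax; split=> //; exact: BA.
  have FA A : H A -> F (sval A) by move=> HA; exists A.
  have FC : F C by apply: filterS (FA _ HA0); have [] := svalP A0.
  have [c cF] := weak_adherence_nonempty hX FF FC CM.
  pose B := \bigcap_(A in H) sval A.
  have iB : weakly_invariant B.
    split.
    - by apply: closed_bigI => A _; have [] := svalP A.
    - move=> x y s s0 s1 Bx By A HA; have [_ cA _ _ _] := svalP A.
      by apply: cA => //; [exact: Bx|exact: By].
    - by move=> x Bx; have [_ _ A0C _ _] := svalP A0; apply: A0C; exact: Bx.
    - exists c => A HA; have [clA cA _ _ _] := svalP A.
      by apply: cF => //; exact: FA.
    - move=> q Bq c' wc' A HA; have [_ _ _ _ wA] := svalP A.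
      by apply: (wA q) => //; exact: Bq.
  exists (exist _ B iB) => A HA; apply/asboolP => /= x; exact.
exists K; split=> // A iA AK.
by have /asboolP := Kmin (exist _ A iA) (introT (asboolP _) AK).
Qed.

(** Allows the points along [F] to be taken of the form [T^n w], with [w] in a prescribed member, so
    that they can be compared with [T^n p]. *)
Definition image_stable (F : set_system X) := forall A, F A -> F (T @` A).

Lemma orbit_image_stable q : image_stable (orbit q @ \oo).
Proof.
move=> A [N _ NA]; exists N.+1 => // -[//|n] Nn.
by exists (orbit q n) => //; exact: NA.
Qed.

Lemma image_stable_iter F n A : image_stable F -> F A -> F (iter n T @` A).
Proof.
move=> iF FA; elim: n => [|n IH].
  rewrite (_ : iter 0 T @` A = A)//.
  by apply/seteqP; split=> [_ [x Ax <-]|x Ax]//; exists x.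
rewrite (_ : iter n.+1 T @` A = T @` (iter n T @` A)); first exact: iF.
apply/seteqP; split=> [_ [x Ax <-]|_ [_ [x Ax <-] <-]]; last by exists x.
by exists (iter n T x) => //; exists x.
Qed.

Lemma asymptotic_ball_orbit F t p : Filter F -> F C -> image_stable F ->
  C p -> asymptotic_ball F t p ->
  forall e, 0 < e -> \forall n \near \oo, asymptotic_ball F (t + e) (orbit p n).
Proof.
move=> FF FC iF Cp bp e e0; apply: filterS (hT e0) => n Tn e' e'0.
apply: (filterS _ (image_stable_iter n iF (filterI FC (bp _ e'0)))).
move=> _ [w [Cw /= wp] <-] /=.
by rewrite (le_trans (Tn _ _ Cw Cp))// addrAC lerD2r.
Qed.

Variable K : set X.
Hypothesis iK : weakly_invariant K.
Hypothesis Kmin : forall A, weakly_invariant A -> A `<=` K -> K `<=` A.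

Let KC : K `<=` C. Proof. by case: iK. Qed.
Let clK : closed K. Proof. by case: iK. Qed.
Let cK : segment_closed K. Proof. by case: iK. Qed.

(** The part of [K] in the ball is weakly invariant: orbits of its points eventually enter every
    larger ball, which is closed and convex and so keeps their weak limits. *)
Lemma asymptotic_ball_minimal F t p : Filter F -> F C -> image_stable F ->
  K p -> asymptotic_ball F t p -> K `<=` asymptotic_ball F t.
Proof.
move=> FF FC iF Kp bp.
suff iA : weakly_invariant (K `&` asymptotic_ball F t).
  by move=> q /(Kmin iA (@subIsetl _ _ _)) [].
split.
- by apply: closedI => //; exact: asymptotic_ball_closed.
- move=> x y s s0 s1 [Kx bx] [Ky by_]; split; first exact: cK.
  exact: asymptotic_ball_segment.
- by move=> x [/KC].
- by exists p.
- move=> q [Kq bq] c wc; split; first by have [_ _ _ _ wK] := iK; exact: wK wc.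
  apply: asymptotic_ball_inf => e e0; apply: wc.
  + exact: asymptotic_ball_closed.
  + exact: asymptotic_ball_segment.
  + exact: asymptotic_ball_orbit (KC Kq) bq _ e0.
Qed.

(** The radius is computed at one point [a]; by minimality, a bound valid at some point of [K] is
    valid on all of [K]. *)
Lemma asymptotic_radius F : ProperFilter F -> F C -> image_stable F ->
  exists r, [/\ 0 <= r, K `<=` asymptotic_ball F r &
    forall t p, K p -> t < r -> ~ asymptotic_ball F t p].
Proof.
move=> FF FC iF; have [a Ka] : K !=set0 by case: iK.
pose E := [set t | asymptotic_ball F t a].
have Elb t : asymptotic_ball F t a -> 0 <= t.
  move=> bt; apply/ler_addgt0Pr => e e0.
  by have [w /= wa] := filter_ex (bt e e0); exact: le_trans wa.
have E0 : E !=set0.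
  exists (M + M) => e e0; apply: filterS FC => w Cw /=.
  rewrite (le_trans (ler_normB _ _))// ler_wpDr ?(ltW e0)//.
  by rewrite lerD// CM//; exact: KC.
have Elb' : has_lbound E by exists 0 => t; exact: Elb.
exists (inf E); split.
- by apply: lb_le_inf => // t; exact: Elb.
- apply: (asymptotic_ball_minimal _ FC iF Ka); apply: asymptotic_ball_inf => e e0.
  have [t bt te] := inf_adherent e0 (conj E0 Elb').
  exact: asymptotic_ball_le (ltW te) _ bt.
- move=> t p Kp tr bp.
  have bt : E t by exact: (asymptotic_ball_minimal _ FC iF Kp bp Ka).
  by have := ge_inf Elb' bt; rewrite leNgt tr.
Qed.

(* Averaging: if [u] is asymptotically within [r] of the points of a finite
   subset of [K] and nearly [r]-far from a suitable convex combination of them,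
   then it is nearly [r]-far from each of them. *)
Lemma generic_ultrafilter (J : Type) (F : set_system J) (u : J -> X) r :
  ProperFilter F -> K `<=` asymptotic_ball (u @ F) r ->
  (forall t p, K p -> t < r -> ~ asymptotic_ball (u @ F) t p) ->
  exists U, [/\ UltraFilter U, F `<=` U & forall p e, K p -> 0 < e ->
    U [set j | r - e <= `|u j - p|]].
Proof.
move=> FF Kr rmin; have [a Ka] : K !=set0 by case: iK.
have avg (s : seq X) : (forall p, p \in s -> K p) -> forall e, 0 < e ->
    exists q d, [/\ K q, 0 < d & F [set j | r - d <= `|u j - q| ->
      forall p, p \in s -> r - e <= `|u j - p|]].
  elim: s => [_ e e0|x s IH Ks e e0].
    by exists a, 1; split=> //; apply: nearW.
  have [p ps|q [d [Kq d0 qd]]] := IH _ e e0.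
    by apply: Ks; rewrite inE ps orbT.
  have Kx : K x by apply: Ks; rewrite inE eqxx.
  pose d' := Num.min d e / 3.
  have m0 : 0 < Num.min d e by rewrite lt_min d0.
  have d'0 : 0 < d' by rewrite divr_gt0.
  have d3 : 3 * d' = Num.min d e by rewrite mulrC divfK.
  (* If the distance to the midpoint is at least [r - d'] and those to its ends at most [r + d'],
     then each of the latter is at least [r - 3 * d']. *)
  have [md me] : 3 * d' <= d /\ 3 * d' <= e by rewrite d3 !ge_min !lexx orbT.
  exists (2^-1 *: (x + q)), d'; split=> //; first exact: segment_midpoint.
  have Fx : F [set j | `|u j - x| <= r + d'] := Kr _ Kx _ d'0.
  have Fq : F [set j | `|u j - q| <= r + d'] := Kr _ Kq _ d'0.
  apply: filterS3 qd Fx Fq => j /= jq jx1 jq1 jm.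
  have : `|u j - 2^-1 *: (x + q)| <= 2^-1 * (`|u j - x| + `|u j - q|).
    have -> : u j - 2^-1 *: (x + q) = 2^-1 *: ((u j - x) + (u j - q)).
      by rewrite addrACA -opprD scalerBr scale_half_double.
    by rewrite normrZ gtr0_norm ?invr_gt0// ler_pM2l ?invr_gt0// ler_normD.
  move=> um p; rewrite inE => /predU1P[->|]; first by lra.
  by apply: jq; lra.
pose D := [set z : set J * seq X * R |
  [/\ F z.1.1, forall p, p \in z.1.2 -> K p & 0 < z.2]].
pose B (z : set J * seq X * R) : set J :=
  [set j | z.1.1 j /\ forall p, p \in z.1.2 -> r - z.2 <= `|u j - p|].
have PF : ProperFilter (filter_from D B).
  apply: filter_from_proper.
    apply: filter_from_filter; first exists (setT, [::], 1).
      by split=> //; exact: filterT.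
    move=> [[A s] e] [[A' s'] e'] [/= FA Ks e0] [/= FA' Ks' e'0].
    exists (A `&` A', s ++ s', Num.min e e').
      split=> /=; [exact: filterI| |by rewrite lt_min e0].
      by move=> p; rewrite mem_cat => /orP[/Ks|/Ks'].
    move=> j [/= [Aj A'j] sj]; split; split=> //= p ps.
      rewrite (le_trans _ (sj p _)) ?mem_cat ?ps//.
      by rewrite lerD2l lerN2 ge_min lexx.
    rewrite (le_trans _ (sj p _)) ?mem_cat ?ps ?orbT//.
    by rewrite lerD2l lerN2 ge_min lexx orbT.
  move=> [[A s] e] [/= FA Ks e0]; have [q [d [Kq d0 qd]]] := avg s Ks e e0.
  (* An empty member of the base would place [u] asymptotically within [r - d] of [q]. *)
  apply: contrapT => nB; apply: (rmin (r - d) q Kq); first by rewrite gtrBl.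
  move=> e' e'0; suff : F [set j | `|u j - q| <= r - d + e'] by [].
  apply: filterS2 FA qd => j Aj /= jq; rewrite leNgt; apply/negP => jq'.
  apply: nB; exists j; split=> //=.
  by apply: jq; rewrite ltW// (le_lt_trans _ jq')// lerDl ltW.
have [U [UU sU]] := ultraFilterLemma PF; exists U; split=> //.
- move=> A FA; apply: sU; exists (A, [::], 1); first by split.
  by move=> j [].
- move=> p e Kp e0; apply: sU; exists (setT, [:: p], e).
    by split=> //=; [exact: filterT|move=> q; rewrite inE => /eqP ->].
  by move=> j [_ /(_ p)] /=; rewrite inE eqxx; exact.
Qed.

Lemma ultra_weak_avoid (J : Type) (U : set_system J) (v : J -> X) c D :
  UltraFilter U -> weak_adherence (v @ U) c -> closed D -> segment_closed D ->
  ~ D c -> U [set j | ~ D (v j)].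
Proof.
move=> UU wc clD cD nDc; apply: (ultra_near_not UU) => UD.
by apply: nDc; apply: wc.
Qed.

(** Otherwise the times spent in [D] refine the filter of the orbit, and a weak limit along them
    lies in both [K] and [D]. *)
Lemma orbit_avoid p D : K p -> closed D -> segment_closed D ->
  (forall q, K q -> ~ D q) -> \forall n \near \oo, ~ D (orbit p n).
Proof.
move=> Kp clD cD KD; apply: contrapT => nD.
pose F := within [set n | D (orbit p n)] \oo.
have FF : ProperFilter F.
  split; last exact: within_filter.
  by move=> Fn; apply: nD; apply: filterS Fn => n; exact.
have FC : (orbit p @ F) C by exists 0%N => // n _ _; apply: iterC; exact: KC.
have [c wc] := weak_adherence_nonempty hX (fmap_proper_filter (orbit p) FF) FC CM.
apply: (KD c).
  have [_ _ _ _] := iK; apply; first exact: Kp.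
  apply: weak_adherenceS wc => A [N _ NA]; exists N => // n Nn _; exact: NA.
by apply: wc => //; exists 0%N.
Qed.

(** * Orbits of positive asymptotic radius *)

Section generic_orbit.
Variables (a : X) (r : R).
Hypotheses (Ka : K a) (r_gt0 : 0 < r).
Let x : nat -> X := orbit a.
Hypothesis Kr : K `<=` asymptotic_ball (x @ \oo) r.
Hypothesis r_min : forall t p, K p -> t < r -> ~ asymptotic_ball (x @ \oo) t p.

Let xC n : C (x n). Proof. by apply: iterC; exact: KC. Qed.

Let iter_x i k : iter i T (x k) = x (i + k)%N.
Proof. by rewrite /x /orbit iterD. Qed.

(* Genericity passes from [x k] to [x (k - s)], because
   [|x k - T^s p| <= |x (k - s) - p|] asymptotically; letting [s] tend to infinity
   after [k] thus makes all forward shifts generic. *)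
Lemma shift_generic_ultrafilter : exists U, [/\ UltraFilter U,
  (\oo : set_system nat) `<=` U & forall i p e, K p -> 0 < e ->
  U [set k | r - e <= `|x (i + k)%N - p|]].
Proof.
have [U0 [UU0 sU0 gU0]] := generic_ultrafilter _ Kr r_min.
pose V := (fun sk : nat * nat => (sk.2 - sk.1)%N) @ filter_curry \oo U0.
(* The truncation of the subtraction in [V] is harmless: [U0] contains all tails, so [k] exceeds
   [s]. *)
have [U [UU sU]] := ultraFilterLemma (fmap_proper_filter _ _ : ProperFilter V).
exists U; split=> //.
  move=> A [N _ NA]; apply: sU; exists 0%N => // s _ /=.
  apply: sU0; exists (N + s)%N => // k /= Nsk; apply: NA => /=.
  by clear -Nsk; lia.
move=> i p e Kp e0; have e20 : 0 < e / 2 by rewrite divr_gt0.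
have e40 : 0 < e / 4 by rewrite divr_gt0.
have far : \forall s \near \oo, ~ asymptotic_ball (x @ U0) (r - e / 2) (orbit p s).
  apply: orbit_avoid => //.
  - exact: asymptotic_ball_closed.
  - exact: asymptotic_ball_segment.
  move=> q Kq bq; have h1 : U0 [set k | `|x k - q| <= r - e / 2 + e / 8].
    by apply: bq; rewrite divr_gt0.
  have e80 : 0 < e / 8 by rewrite divr_gt0.
  by have [k /= [k1 k2]] := filter_ex (filterI h1 (gU0 q (e / 8) Kq e80)); lra.
have [N1 _ far1] := far; have [N2 _ T2] := hT e20.
apply: sU; exists (N1 + N2 + i)%N => // s /= Ns.
have Nsi : (N1 + N2 <= s - i)%N by clear -Ns; lia.
have : U0 [set k | ~ (`|x k - orbit p (s - i)| <= r - e / 2)].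
  apply: ultra_near_not => U0s; apply: (far1 (s - i)%N).
    exact: leq_trans (leq_addr _ _) Nsi.
  move=> d d0.
  suff : U0 [set k | `|x k - orbit p (s - i)| <= r - e / 2 + d] by [].
  apply: (filterS _ U0s) => k /= ks.
  by rewrite (le_trans ks)// lerDl ltW.
move=> h; have h' : U0 [set k | (s <= k)%N] by apply: sU0; exists s.
apply: filterS2 h h' => k /= /negP; rewrite -ltNge => ks sk.
(* [T^(s - i)] sends [x (i + (k - s))] to [x k] and [p] to [orbit p (s - i)], whose distance exceeds
   [r - e / 2], and expands distances by at most [e / 2]. *)
have := T2 _ (leq_trans (leq_addl _ _) Nsi) _ _ (xC (i + (k - s))%N) (KC Kp).
rewrite iter_x (_ : s - i + (i + (k - s)) = k)%N.
  by move: ks; rewrite /orbit; lra.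
by clear -Ns sk; lia.
Qed.

Variable U : set_system nat.
Hypotheses (UU : UltraFilter U) (sU : (\oo : set_system nat) `<=` U).
Hypothesis U_generic : forall i p e, K p -> 0 < e ->
  U [set k | r - e <= `|x (i + k)%N - p|].

Let weak_limit i : exists2 c, K c & weak_adherence ((fun k => x (i + k)%N) @ U) c.
Proof.
pose F := (fun k => x (i + k)%N) @ U.
have FC : F C by apply: sU; exists 0%N => // k _; exact: xC.
have FF : ProperFilter F by exact: fmap_proper_filter.
have [c wc] := weak_adherence_nonempty hX FF FC CM.
exists c => //; have [_ _ _ _ wK] := iK; apply: (wK _ Ka).
apply: weak_adherenceS wc => A [N _ NA]; apply: sU; exists N => // k Nk.
by apply: NA => /=; rewrite (leq_trans Nk)// leq_addl.
Qed.

Let point_upper i p e : K p -> 0 < e -> U [set k | `|x (i + k)%N - p| <= r + e].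
Proof.
move=> Kp e0; have [N _ NP] := Kr Kp e0.
by apply: sU; exists N => // k Nk; apply: NP; rewrite /= (leq_trans Nk)// leq_addl.
Qed.

Let x_upper e : 0 < e -> \forall n \near \oo, asymptotic_ball (x @ \oo) (r + e) (x n).
Proof.
move=> e0; apply: (asymptotic_ball_orbit _ _ _ _ (Kr Ka)) => //.
- by exists 0%N => // k _; exact: xC.
- exact: orbit_image_stable.
- exact: KC.
Qed.

Let pair_upper i e : 0 < e ->
  filter_curry U U [set kl | `|x (i + kl.1)%N - x (i + kl.2)%N| <= r + e].
Proof.
move=> e0; have e20 : 0 < e / 2 by rewrite divr_gt0.
have [N _ NP] := x_upper e20; apply: sU; exists N => // k Nk /=.
have [|N' _ N'P] := NP (i + k)%N _ _ e20.
  by rewrite /= (leq_trans Nk)// leq_addl.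
apply: sU; exists N' => // l N'l /=; rewrite distrC (_ : r + e = r + e / 2 + e / 2).
  by apply: N'P; rewrite /= (leq_trans N'l)// leq_addl.
by rewrite -addrA -splitr.
Qed.

(** Genericity concerns points of [K], so it is applied to the weak limit [c] of [x (i + l)]; a ball
    around [x (i + k)] that misses [c] is then avoided for most [l]. *)
Let pair_lower i e : 0 < e ->
  filter_curry U U [set kl | r - e <= `|x (i + kl.1)%N - x (i + kl.2)%N|].
Proof.
move=> e0; have e20 : 0 < e / 2 by rewrite divr_gt0.
have [c Kc wc] := weak_limit i.
apply: (filterS _ (U_generic i Kc e20)) => k /= kc.
pose D := [set q | `|x (i + k)%N - q| <= r - e].
have clD : closed D by exact: norm_ball_closed.
have cD : segment_closed D by exact: norm_ball_segment.
have nDc : ~ D c by rewrite /D /= => kc'; lra.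
apply: (filterS _ (ultra_weak_avoid UU wc clD cD nDc)) => l /= /negP.
by rewrite -ltNge => /ltW.
Qed.

Let pair_far1 i e : 0 < e -> filter_curry U U
  [set kl | r - e <= `|x (i + kl.1)%N - 2^-1 *: (x (i + kl.2)%N + a)|].
Proof.
move=> e0; have e20 : 0 < e / 2 by rewrite divr_gt0.
have [c Kc wc] := weak_limit i.
have Km : K (2^-1 *: (c + a)) by exact: segment_midpoint.
apply: (filterS _ (U_generic i Km e20)) => k /= kc.
have clD := closed_affine_preimage (a := 2^-1) (p := 2^-1 *: a)
  (norm_ball_closed (p := x (i + k)%N) (t := r - e)).
have cD := segment_affine_preimage (a := 2^-1) (p := 2^-1 *: a)
  (norm_ball_segment (p := x (i + k)%N) (t := r - e)).
have nDc : ~ `|x (i + k)%N - (2^-1 *: c + 2^-1 *: a)| <= r - e.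
  by rewrite -scalerDr => kc'; lra.
apply: (filterS _ (ultra_weak_avoid UU wc clD cD nDc)) => l /= /negP.
by rewrite -ltNge -scalerDr => /ltW.
Qed.

(** Here the outer index [k] moves the center. The centers asymptotically too close to [x (i + l)]
    form a closed convex set missing [(c + a) / 2], so most [(x (i + k) + a) / 2] avoid it. *)
Let pair_far2 i e : 0 < e -> filter_curry U U
  [set kl | r - e <= `|x (i + kl.2)%N - 2^-1 *: (x (i + kl.1)%N + a)|].
Proof.
move=> e0; have e40 : 0 < e / 4 by rewrite divr_gt0.
have [c Kc wc] := weak_limit i.
have Km : K (2^-1 *: (c + a)) by exact: segment_midpoint.
pose D := asymptotic_ball ((fun k => x (i + k)%N) @ U) (r - e).
have clD : closed D by exact: asymptotic_ball_closed.
have cD : segment_closed D by exact: asymptotic_ball_segment.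
have nDc : ~ D (2^-1 *: c + 2^-1 *: a).
  rewrite -scalerDr => Dc.
  have Uc : U [set k | `|x (i + k)%N - 2^-1 *: (c + a)| <= r - e + e / 4].
    exact: Dc.
  by have [k /= [k1 k2]] := filter_ex (filterI (U_generic i Km e40) Uc); lra.
apply: (filterS _ (ultra_weak_avoid UU wc
  (closed_affine_preimage (a := 2^-1) (p := 2^-1 *: a) clD)
  (segment_affine_preimage (a := 2^-1) (p := 2^-1 *: a) cD) nDc)) => k /=.
rewrite -scalerDr => Dk.
have [d d0 dk] : exists2 d, 0 < d &
    ~ U [set l | `|x (i + l)%N - 2^-1 *: (x (i + k)%N + a)| <= r - e + d].
  apply: contrapT => nd; apply: Dk => d d0; apply: contrapT => nU; apply: nd.
  by exists d.
apply: (filterS _ (ultra_near_not UU dk)) => l /= /negP; rewrite -ltNge.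
by move=> /ltW; apply: le_trans; rewrite lerDl ltW.
Qed.

Let mid i (kl : nat * nat) := 2^-1 *: (x (i + kl.1)%N + x (i + kl.2)%N).
Let Tmid i (kl : nat * nat) := iter i T (2^-1 *: (x kl.1 + x kl.2)).

Let TmidC i kl : C (Tmid i kl).
Proof. by apply: iterC; exact: segment_midpoint. Qed.

(** As [T^i] is nearly nonexpansive, [Tmid] is almost a metric midpoint of [x (i + k)] and
    [x (i + l)]; [metric_midpoint_unique] applies with [a] as third point. *)
Let Tmid_mid eps : 0 < eps -> \forall i \near \oo,
  filter_curry U U [set kl | `|Tmid i kl - mid i kl| <= eps * r].
Proof.
move=> eps0; have [e e0 H] := metric_midpoint_unique hX eps0.
have er0 : 0 < e * r by rewrite mulr_gt0.
have er40 : 0 < e * r / 4 by rewrite divr_gt0.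
have er20 : 0 < e * r / 2 by rewrite divr_gt0.
apply: filterS (hT er40) => i Ti.
have h1 := pair_upper i er0; have h2 := pair_upper 0 er20.
have h3 := pair_far1 i er0; have h4 := pair_far2 i er0.
have h5 : filter_curry U U [set kl | `|x (i + kl.1)%N - a| <= r + e * r].
  by apply: (filterS _ (point_upper i Ka er0)) => k ka; exact: filterE.
have h6 : filter_curry U U [set kl | `|x (i + kl.2)%N - a| <= r + e * r].
  by apply: (@filterE _ U) => k; exact: point_upper.
near=> kl.
have Er : (1 + e) * r = r + e * r by rewrite mulrDl mul1r.
have Er' : (1 - e) * r = r - e * r by rewrite mulrBl mul1r.
have xx : `|x kl.1 - x kl.2| <= r + e * r / 2 by near: kl.
(* Half of [r + e * r / 2] plus the error [e * r / 4] of [T^i] is exactly [(1 + e) * r / 2]. *)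
have near_mid (y y' : X) : C y -> C y' -> `|y - y'| <= r + e * r / 2 ->
    `|iter i T (2^-1 *: (y + y')) - iter i T y| <= (1 + e) * r / 2.
  move=> Cy Cy' yy'; have Cm := segment_midpoint cC Cy Cy'.
  apply: le_trans (Ti _ _ Cm Cy) _.
  have -> : 2^-1 *: (y + y') - y = 2^-1 *: (y' - y).
    by rewrite -[X in _ - X]scale_half_double -scalerBr opprD addrACA subrr add0r.
  by rewrite normrZ gtr0_norm ?invr_gt0// distrC Er; lra.
apply: (H r (x (i + kl.1)%N) (x (i + kl.2)%N) a); rewrite ?Er ?Er' //; try by near: kl.
- by rewrite -iter_x -Er; apply: near_mid; [exact: xC|exact: xC|].
- rewrite -iter_x /Tmid (addrC (x kl.1)) -Er; apply: near_mid; [exact: xC|exact: xC|].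
  by rewrite distrC.
Unshelve. all: by end_near. Qed.

(* [T^i ((x_k + x_l) / 2)] is studied along [G3], that is in the limit
   [l -> U], then [k -> U], then [i -> oo]; there it is close to
   [(x_(i + k) + x_(i + l)) / 2] by [metric_midpoint_unique]. *)
Let G3 : set_system (nat * (nat * nat)) := filter_curry \oo (filter_curry U U).
Let TM (z : nat * (nat * nat)) := Tmid z.1 z.2.

Let G3_tail N (P : set (nat * (nat * nat))) :
  (forall i k l, (N <= i)%N -> (N <= k)%N -> (N <= l)%N -> P (i, (k, l))) -> G3 P.
Proof.
move=> NP; exists N => // i Ni; apply: sU; exists N => // k Nk.
by apply: sU; exists N => // l Nl; exact: NP.
Qed.

Let G3_all (P : set (nat * (nat * nat))) :
  (forall i, filter_curry U U [set kl | P (i, kl)]) -> G3 P.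
Proof. by move=> PP; exists 0%N => // i _; exact: PP. Qed.

Let TM_C : (TM @ G3) C.
Proof. by apply: (@filterE _ G3) => z; exact: TmidC. Qed.

Let TM_stable : image_stable (TM @ G3).
Proof.
move=> A [N _ NA]; exists N.+1 => // -[//|i] Ni.
by apply: (filterS _ (NA i Ni)) => kl Akl; exists (Tmid i kl).
Qed.

(* Otherwise the weak limits of [x (i + k)], [k -> U], would accumulate, as
   [i -> oo], at a point of [K] asymptotically closer than [r] to the orbit. *)
Let TM_radius b eps : K `<=` asymptotic_ball (TM @ G3) b -> 0 < eps ->
  (1 - eps) * r <= b.
Proof.
move=> Kb eps0; rewrite leNgt; apply/negP => br.
pose d := ((1 - eps) * r - b) / 4.
have d0 : 0 < d by rewrite divr_gt0// subr_gt0.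
pose be := b + d + d + eps * r.
have ber : be < r.
  have d4 : d * 4 = (1 - eps) * r - b by rewrite divfK.
  by rewrite /be; move: d4 d0; rewrite mulrBl mul1r; set u := eps * r; lra.
have /choice[c cP] : forall i, exists c, K c /\
    weak_adherence ((fun k => x (i + k)%N) @ U) c.
  by move=> i; have [c Kc wc] := weak_limit i; exists c.
(* The orbit of [a] is asymptotically within [b + d] of [Tmid], hence within [be] of [mid]; weak
   limits in [l], then in [k], replace both ends of [mid] by [c i]. *)
have close : \forall s \near \oo, \forall i \near \oo, `|x s - c i| <= be.
  have b_orbit : \forall s \near \oo, asymptotic_ball (TM @ G3) (b + d) (x s).
    exact: asymptotic_ball_orbit (KC Ka) (Kb _ Ka) _ d0.
  apply: (filterS _ b_orbit) => s /(_ _ d0) bs.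
  have bs' : \forall i \near \oo, filter_curry U U
    [set kl | `|Tmid i kl - x s| <= b + d + d] := bs.
  apply: filterS2 bs' (Tmid_mid eps0) => i T1 T2.
  have T3 : filter_curry U U [set kl | `|x s - mid i kl| <= be].
    apply: filterS2 T1 T2 => kl /= t1 t2.
    have -> : x s - mid i kl = (Tmid i kl - mid i kl) - (Tmid i kl - x s).
      by rewrite opprB [RHS]addrC addrA subrK.
    by rewrite (le_trans (ler_normB _ _))// /be addrC lerD.
  have [_ wc] := cP i.
  have clB q := closed_affine_preimage (a := 2^-1) (p := 2^-1 *: q)
    (norm_ball_closed (p := x s) (t := be)).
  have cB q := segment_affine_preimage (a := 2^-1) (p := 2^-1 *: q)
    (norm_ball_segment (p := x s) (t := be)).
  suff : `|x s - (2^-1 *: c i + 2^-1 *: c i)| <= be.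
    by rewrite -scalerDr scale_half_double.
  apply: (wc _ (clB (c i)) (cB (c i))).
  suff : U [set k | `|x s - (2^-1 *: x (i + k)%N + 2^-1 *: c i)| <= be] by [].
  have {}T3 : U [set k | U [set l | `|x s - mid i (k, l)| <= be]] := T3.
  apply: (filterS _ T3) => k Tk /=; rewrite [2^-1 *: _ + _]addrC.
  apply: (wc _ (clB (x (i + k)%N)) (cB (x (i + k)%N))).
  suff : U [set l | `|x s - (2^-1 *: x (i + l)%N + 2^-1 *: x (i + k)%N)| <= be] by [].
  apply: (filterS _ Tk) => l /=.
  by rewrite /mid /= scalerDr [2^-1 *: _ + _]addrC.
have cC' : (c @ \oo) C.
  by exists 0%N => // i _; apply: KC; have [] := cP i.
have [q wq] := weak_adherence_nonempty hX (fmap_proper_filter c _) cC' CM.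
have Kq : K q by apply: wq => //; exists 0%N => // i _; have [] := cP i.
apply: (r_min Kq ber) => e e0; apply: filterS close => s cs.
have sq : `|x s - q| <= be.
  apply: (wq [set q | `|x s - q| <= be]) cs.
    exact: norm_ball_closed.
  exact: norm_ball_segment.
by rewrite /preimage /= (le_trans sq)// lerDl ltW.
Qed.

Lemma generic_orbit_absurd : False.
Proof.
have [E E0 HE] := quadruple_contradiction hX.
(* All errors below are small multiples of [d], within the [8 * d = E * r] allowed by
   [quadruple_contradiction]. *)
have E80 : 0 < E / 8 by rewrite divr_gt0.
pose d := E / 8 * r.
have d0 : 0 < d by rewrite mulr_gt0.
have [b [_ Kb bmin]] := asymptotic_radius _ TM_C TM_stable.
have rb : r - d <= b by have := TM_radius Kb E80; rewrite mulrBl mul1r.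
have [W [UW sW gW]] := generic_ultrafilter _ Kb bmin.
pose m z := mid z.1 z.2.
have [c Kc wc] : exists2 c, K c & weak_adherence (m @ W) c.
  have mC : (m @ W) C.
    apply: sW; apply: (@filterE _ G3) => z.
    by apply: segment_midpoint => //; exact: xC.
  have [c wc] := weak_adherence_nonempty hX (fmap_proper_filter m _) mC CM.
  exists c => //; have [_ _ _ _ wK] := iK; apply: (wK _ Ka) => A clA cA [N _ NA].
  apply: wc => //; apply: sW; apply: (G3_tail (N := N)) => i k l Ni Nk Nl.
  by apply: segment_midpoint => //; apply: NA; rewrite /= (leq_trans Ni)// leq_addr.
(* With this weight, [m z] and [a] combine into the barycenter of [x (i + k)], [x (i + l)] and [a],
   which [quadruple_contradiction] keeps away from [p]; there [a] is taken as [q]. *)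
pose third := 2 / 3 : R.
have t3 : 1 - third = 3^-1 by rewrite /third; lra.
have Kq : K (third *: c + (1 - third) *: a).
  by apply: cK => //; rewrite /third; lra.
(* [p] will be some [x k0], possibly outside [K]: the genericity of [TM] is used at [(c0 + a) / 2]
   and transferred to [(p + a) / 2] for most [k0]. *)
have [c0 Kc0 wc0] := weak_limit 0.
pose D := asymptotic_ball (TM @ W) (b - d).
have clD : closed D by exact: asymptotic_ball_closed.
have cD : segment_closed D by exact: asymptotic_ball_segment.
have nDc0 : ~ D (2^-1 *: c0 + 2^-1 *: a).
  rewrite -scalerDr => Dc; have d40 : 0 < d / 4 by rewrite divr_gt0.
  have Km : K (2^-1 *: (c0 + a)) by exact: segment_midpoint.
  have h : W [set z | `|TM z - 2^-1 *: (c0 + a)| <= b - d + d / 4] by exact: Dc.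
  by have [z /= [z1 z2]] := filter_ex (filterI (gW _ _ Km d40) h); lra.
have U1 := U_generic 0 Kq d0.
have U2 := ultra_weak_avoid UU wc0
  (closed_affine_preimage (a := 2^-1) (p := 2^-1 *: a) clD)
  (segment_affine_preimage (a := 2^-1) (p := 2^-1 *: a) cD) nDc0.
have U3 : U [set k | asymptotic_ball (x @ \oo) (r + d) (x k)].
  by apply: sU; exact: x_upper.
have U4 := point_upper 0 Ka d0.
have [k0 [[/= k1 k2] [k3 k4]]] := filter_ex (filterI (filterI U1 U2) (filterI U3 U4)).
rewrite !add0n in k1 k2 k4; set p := x k0 in k1 k2 k3 k4.
have W1 : W [set z | ~ (`|p - (third *: m z + (1 - third) *: a)| <= r - d - d)].
  apply: (ultra_weak_avoid UW wc
    (closed_affine_preimage (a := third) (p := (1 - third) *: a)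
      (norm_ball_closed (p := p) (t := r - d - d)))
    (segment_affine_preimage (a := third) (p := (1 - third) *: a)
      (norm_ball_segment (p := p) (t := r - d - d)))) => /= h.
  by lra.
have W2 : W [set z | b - d <= `|TM z - 2^-1 *: (p + a)|].
  have [e e0 eP] : exists2 e, 0 < e &
      ~ W [set z | `|TM z - 2^-1 *: (p + a)| <= b - d + e].
    apply: contrapT => ne; apply: k2 => e e0; apply: contrapT => nW; apply: ne.
    by exists e => //; rewrite scalerDr.
  apply: (filterS _ (ultra_near_not UW eP)) => z /= /negP; rewrite -ltNge => /ltW.
  by apply: le_trans; rewrite lerDl ltW.
have W3 : W [set z | `|TM z - m z| <= d] := sW _ (Tmid_mid E80).
have Ed : E * r = 8 * d by rewrite /d mulrA mulrCA divff// mulr1.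
have Er : (1 + E) * r = r + 8 * d by rewrite mulrDl mul1r Ed.
have Er' : (1 - E) * r = r - 8 * d by rewrite mulrBl mul1r Ed.
have d20 : 0 < 2 * d by rewrite mulr_gt0.
have W4 : W [set z | `|x (z.1 + z.2.1)%N - x (z.1 + z.2.2)%N| <= r + d].
  by apply: sW; apply: G3_all => i; exact: pair_upper.
have W5 : W [set z | r - d <= `|x (z.1 + z.2.1)%N - x (z.1 + z.2.2)%N|].
  by apply: sW; apply: G3_all => i; exact: pair_lower.
have tail q : (\forall n \near \oo, `|x n - q| <= r + d + d) ->
    W [set z | `|x (z.1 + z.2.1)%N - q| <= r + d + d /\
               `|x (z.1 + z.2.2)%N - q| <= r + d + d].
  move=> [N _ NP]; apply: sW; apply: (G3_tail (N := N)) => i k l Ni _ _ /=.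
  by split; apply: NP; rewrite /= (leq_trans Ni)// leq_addr.
have W6 := tail _ (k3 _ d0).
have W7 : W [set z | `|x (z.1 + z.2.1)%N - a| <= r + d + d /\
                     `|x (z.1 + z.2.2)%N - a| <= r + d + d].
  apply: tail; have [N _ NP] := Kr Ka d0; exists N => // n Nn.
  by rewrite (le_trans (NP n Nn))// lerDl ltW.
have [z [[[z1 z2] [z3 z4]] [z5 [[z6 z6'] [z7 z7']]]]] := filter_ex
  (filterI (filterI (filterI W1 W2) (filterI W3 W4))
    (filterI W5 (filterI W6 W7))).
have [le_d le_2d] : r + d <= r + 8 * d /\ r + d + d <= r + 8 * d by split; lra.
have lt_d : r - 8 * d <= r - d by lra.
have := HE r (x (z.1 + z.2.1)%N) (x (z.1 + z.2.2)%N) p a r_gt0.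
rewrite Er Er' => /(_ (le_trans z4 le_d) (le_trans z6 le_2d) (le_trans z7 le_2d)).
move=> /(_ (le_trans z6' le_2d) (le_trans z7' le_2d) (le_trans k4 le_d)).
move: z1 z2 z3 z5 => /= /negP; rewrite -ltNge => z1 z2 z3 z5 H.
have /H{H} H : r - 8 * d <= `|2^-1 *: (x (z.1 + z.2.1)%N + x (z.1 + z.2.2)%N) -
    2^-1 *: (p + a)|.
  (* The left side is at least [b - d >= r - 2 * d] and the first term is at most [d], which leaves
     [r - 3 * d]. *)
  have : `|TM z - 2^-1 *: (p + a)| <= `|TM z - m z| + `|m z - 2^-1 *: (p + a)|.
    by rewrite (le_trans _ (ler_normD _ _))// addrA subrK.
  by rewrite /m /mid; lra.
have : `|x (z.1 + z.2.1)%N - x (z.1 + z.2.2)%N| < r - 8 * d.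
  apply: H; rewrite scalerDr -t3.
  have -> : (1 - third) *: (x (z.1 + z.2.1)%N + x (z.1 + z.2.2)%N) = third *: m z.
    by rewrite /m /mid scalerA; congr (_ *: _); rewrite t3 /third; field.
  by rewrite (le_trans _ (ltW z1))//; lra.
by rewrite ltNge (le_trans lt_d z5).
Qed.

End generic_orbit.

Lemma orbit_cvg_self : exists2 a, K a & orbit a @ \oo --> a.
Proof.
have [a Ka] : K !=set0 by case: iK.
have aC : (orbit a @ \oo) C.
  by exists 0%N => // n _; apply: iterC; exact: KC.
have [r [r_ge0 Kr r_min]] := asymptotic_radius _ aC (@orbit_image_stable a).
have [r0|r_neq0] := eqVneq r 0.
  exists a => //; apply/cvgrPdist_le => e e0.
  have : \forall n \near \oo, `|orbit a n - a| <= r + e := Kr a Ka e e0.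
  by rewrite r0 add0r => ae; apply: (filterS _ ae) => n; rewrite distrC.
have r_gt0 : 0 < r by rewrite lt_neqAle eq_sym r_neq0.
have [U [UU sU gU]] := shift_generic_ultrafilter Ka Kr r_min.
by case: (generic_orbit_absurd Ka r_gt0 Kr r_min UU sU gU).
Qed.

End asymptotically_nonexpansive.

(** * The fixed point *)

Lemma convex_set_segment (R : realType) (X : normedModType R) (C : set X) :
  convex_set (C : set (convex_lmodType X)) -> segment_closed C.
Proof.
move=> cC x y t t0 t1 Cx Cy.
have t01 : Itv.spec (@Itv.num_sem R) (Itv.Real `[0%Z, 1%Z]) t.
  by apply/and3P; split; rewrite ?num_real// bnd_simp.
have := cC x y (Itv.mk t01) (mem_set Cx) (mem_set Cy).
by move=> /set_mem.
Qed.

Lemma intermediate_near (R : realType) (X : normedModType R) (C : set X)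
    (T : X -> X) : asymptotically_nonexpansive_intermediate C T ->
  forall e : R, 0 < e -> \forall n \near \oo, forall x y, C x -> C y ->
    `|iter n T x - iter n T y| <= `|x - y| + e.
Proof.
move=> [_ hT] e e0.
have : (limn_esup (fun n => ereal_sup
     [set (`|iter n T x - iter n T y| - `|x - y|)%:E | x in C & y in C]) < e%:E)%E.
  by apply: le_lt_trans hT _; rewrite lte_fin.
move=> /ereal_inf_lt[_ [V V_oo <-] supV]; apply: (filterS _ V_oo) => n Vn x y Cx Cy.
rewrite -lerBlDl -lee_fin; apply: le_trans (ltW supV).
apply: (@le_trans _ _ (ereal_sup
    [set (`|iter n T x - iter n T y| - `|x - y|)%:E | x in C & y in C])).
  by apply: ereal_sup_ubound; exists x => //; exists y.
by apply: ereal_sup_ubound; exists n.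
Qed.

Theorem corollary2p6 (R : realType) (X : completeNormedModType R) (C : set X)
  (hX : uniformly_noncreasy X)
  (C0 : C !=set0) (Cbounded : bounded_set C) (Cclosed : closed C)
  (Cconvex : convex_set (C : set (convex_lmodType X)))
  (T : {fun C >-> C})
  (hT : asymptotically_nonexpansive_intermediate C T) :
  exists2 x, C x & T x = x.
Proof.
have [M CM] : exists M, forall x, C x -> `|x| <= M.
  have [M [_ HM]] := Cbounded; exists (M + 1) => x Cx.
  by apply: HM => //; rewrite ltrDl.
have cC := convex_set_segment Cconvex.
have TC x : C x -> C (T x) by move=> Cx; exact: funS.
have hT' := intermediate_near hT.
have [K [iK Kmin]] := minimal_weakly_invariant hX C0 Cclosed cC CM TC.
have [a Ka Ta] := orbit_cvg_self hX cC CM TC hT' iK Kmin.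
have Ca : C a by have [_ _ KC _ _] := iK; exact: KC.
exists a => //; have [Tcont _] := hT.
have Ta1 : (fun n => iter n.+1 T a) @ \oo --> a.
  by rewrite (cvg_shiftS (fun n => iter n T a)).
(* Continuity holds only within [C], which contains the orbit; the shifted orbit thus tends to both
   [a] and [T a]. *)
have TTa : (fun n => iter n.+1 T a) @ \oo --> T a.
  have /subspace_continuousP /(_ a Ca) Ta_cont := Tcont.
  apply: cvg_trans Ta_cont => A TA; have [N _ NA] := Ta _ TA.
  by exists N => // n Nn; apply: (NA n Nn); exact: iterC.
exact: (cvg_unique _ TTa Ta1).
Qed.
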